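(* Let $k\ge 2$ be an integer and let $\mathcal{P}_k=(p_i)_{i=0}^\infty$ be the pattern sequence over $\mathbb{F}_2$ associated with the all-one pattern of length $k$. For every integer $N\ge 2^{k+3}-7$, the $N$th maximum order complexity of $\mathcal{P}_k$ satisfies $$M(\mathcal{P}_k,N)=(2^{k-1}-1)\,2^\ell+1,\qquad\text{where}\qquad \ell=\left\lceil \frac{\log \bigl(N/(2^k-1)\bigr)}{\log 2}\right\rceil-1 .$$
   Context: For a positive integer $k$, the pattern sequence $\mathcal{P}_k=(p_i)_{i=0}^\infty$ over the two-element field $\mathbb{F}_2$ is defined by $p_0=0$ and, for $i=1,2,\ldots$, $p_i=p_{\lfloor i/2\rfloor}+1$ if $i\equiv -1 \bmod 2^k$ and $p_i=p_{\lfloor i/2\rfloor}$ otherwise (equivalently, $p_i$ is the parity of the number of, possibly overlapping, occurrences of the all-one pattern of length $k$ in the binary expansion of $i$). For $k=2$ this is the Rudin-Shapiro sequence. For a binary sequence $\mathcal{S}=(s_i)_{i=0}^\infty$ over $\mathbb{F}_2$ and a positive integer $N$, the $N$th maximum order complexity $M(\mathcal{S},N)$ is defined as follows. If $(s_0,\ldots,s_{N-2})$ is not a constant tuple $(a,\ldots,a)$ with $a\in\{0,1\}$, then $M(\mathcal{S},N)$ is the smallest positive integer $M$ such that there is a polynomial $f(x_1,\ldots,x_M)\in\mathbb{F}_2[x_1,\ldots,x_M]$ with $$s_{i+M}=f(s_i,s_{i+1},\ldots,s_{i+M-1}),\quad 0\le i\le N-M-1.$$ If $s_i=a$ for all $i=0,\ldots,N-2$,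 then $M(\mathcal{S},N)=0$ if $s_{N-1}=a$ and $M(\mathcal{S},N)=N-1$ if $s_{N-1}\ne a$. *)

(* Defs.v *)
From mathcomp Require Import all_boot all_order all_algebra.
From mathcomp Require Import boolp.
From mathcomp Require Import mpoly.

Set Implicit Arguments.
Unset Strict Implicit.
Unset Printing Implicit Defensive.

Import GRing.Theory.
Local Open Scope ring_scope.

(* [i] is itself enough fuel, since halving strictly decreases a positive
   index; [pattern_seq0] and [pattern_seqE] are the defining equations. *)
Fixpoint pattern_seq_rec (k fuel i : nat) : 'F_2 :=
  if fuel isn't n.+1 then 0 else
  if i == 0%N then 0 else
  if (i == (2 ^ k).-1 %[mod 2 ^ k])%N then pattern_seq_rec k n i./2 + 1
  else pattern_seq_rec k n i./2.

Definition pattern_seq (k i : nat) : 'F_2 := pattern_seq_rec k i i.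

Lemma pattern_seq_rec_fuel (k n i : nat) :
  (i <= n)%N -> pattern_seq_rec k n i = pattern_seq k i.
Proof.
rewrite /pattern_seq; elim/ltn_ind: i n => -[|i] IHi [|n] // le_in.
have lt_h : (i.+1./2 < i.+1)%N by rewrite -divn2 ltn_Pdiv.
rewrite [LHS]/= [RHS]/= -/(uphalf i).
have le_hi : (i.+1./2 <= i)%N by rewrite -ltnS.
by rewrite (IHi _ lt_h n (leq_trans le_hi le_in)) (IHi _ lt_h i le_hi).
Qed.

Lemma pattern_seq0 (k : nat) : pattern_seq k 0 = 0.
Proof. by []. Qed.

Lemma pattern_seqE (k i : nat) : (0 < i)%N ->
  pattern_seq k i =
    if (i == (2 ^ k).-1 %[mod 2 ^ k])%N then pattern_seq k i./2 + 1
    else pattern_seq k i./2.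
Proof.
case: i => // i _.
have le_h : (i.+1./2 <= i)%N by rewrite -ltnS -divn2 ltn_Pdiv.
by rewrite {1}/pattern_seq [LHS]/= -/(uphalf i) !(pattern_seq_rec_fuel k le_h).
Qed.

(* The index range 0 <= i <= N - M - 1 is written [i + M < N], so that it is
   empty for M >= N. *)
Definition has_recurrence (s : nat -> 'F_2) (N M : nat) : Prop :=
  exists f : {mpoly 'F_2[M]}, forall i : nat, (i + M < N)%N ->
    s (i + M)%N = f.@[fun j : 'I_M => s (i + j)%N].

Lemma ex_recurrence (s : nat -> 'F_2) (N : nat) :
  exists M : nat, (0 < M)%N && `[< has_recurrence s N M >].
Proof.
exists N.+1; apply/andP; split=> //; apply/asboolP; exists 0 => i.
by rewrite addnS ltnNge (leq_trans (leq_addl i N)).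
Qed.

(* When N = 1 the tuple (s 0, .., s (N - 2)) is empty and the value is 0,
   whichever constant is chosen. *)
Definition max_order_complexity (s : nat -> 'F_2) (N : nat) : nat :=
  if [forall i : 'I_N.-1, s i == s 0%N] then
    if s N.-1 == s 0%N then 0%N else N.-1
  else ex_minn (ex_recurrence s N).

(* Main.v *)
(** Put H = 2^(k-1), and let y_n record whether p_(n-1) <> p_n. The recursion
    for P_k becomes y_(2n) = y_n + [H | n] and, for odd n, y_n = [2H | n + 1].

    If y agrees on windows of length 4H at i and j, then i and j have the same
    parity: otherwise the explicit values at odd indices would force two
    consecutive multiples of H to be multiples of 2H. Once the parities agree,
    these values give i = j mod 2H, and halving the indices doubles the modulus
    with the window length, so that windows of length 2^l (H - 1) with l >= 3
    force i = j mod 2^l H.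

    For such i and j, y_n depends only on n mod 2^l H unless 2^l | n, and
    y_(2^l a) + y_(2^l b) = y_a + y_b when a = b mod H; this reduces the next
    term of the windows to the case l = 0, where all indices are at most 4H - 3
    and y_n = 1 exactly for n = 2H - 1 and n = 2H. The windows starting at 0 and
    2^l H agree on 2^l (H - 1) terms and then differ, whence the lower bound. *)

Require Import Defs.
From mathcomp Require Import all_boot all_order all_algebra.
From mathcomp Require Import zify.
From mathcomp Require mpoly.
Import Order.TTheory GRing.Theory Num.Theory.

(** The first equation cannot extend to n = 0: there H divides n, and it would make [y 0] its own
    negation. *)
Definition halving_rule (H : nat) (y : nat -> bool) : Prop :=
  (forall n, 0 < n -> y n.*2 = y n (+) (H %| n)) /\
  (forall n, odd n -> y n = (H.*2 %| n.+1)).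

(** * Congruences and divisibility *)

Lemma ex_dvdn_addr (d n : nat) : 0 < d -> exists2 t, t < d & d %| n + t.
Proof.
move=> d_gt0; exists ((d - n %% d) %% d); first exact: ltn_pmod.
by rewrite /dvdn modnDmr -modnDml subnKC ?modnn // ltnW // ltn_pmod.
Qed.

Lemma eqmodn_dvd_addr (d i j t : nat) :
  d %| i + t -> d %| j + t -> i = j %[mod d].
Proof.
move=> /eqP it /eqP jt; apply/eqP; rewrite -(eqn_modDr t).
by rewrite it jt.
Qed.

Lemma eqmodn_dvd (d i j t : nat) :
  i = j %[mod d] -> (d %| i + t) = (d %| j + t).
Proof. by move=> ij; rewrite /dvdn -modnDml ij modnDml. Qed.

Lemma eqmodn_dvdr (d d' i j : nat) :
  d' %| d -> i = j %[mod d] -> i = j %[mod d'].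
Proof. by move=> dd ij; rewrite -(modn_dvdm i dd) ij modn_dvdm. Qed.

Lemma eqmodn_double (d i j : nat) :
  (i.*2 = j.*2 %[mod d.*2]) <-> (i = j %[mod d]).
Proof.
rewrite -!muln2 -!muln_modl; split=> [|-> //].
by move/eqP; rewrite eqn_pmul2r // => /eqP.
Qed.

Lemma dvdn_double (d n : nat) : (d.*2 %| n.*2) = (d %| n).
Proof. by rewrite -!muln2 dvdn_pmul2r. Qed.

Lemma eqmodn_odd (d i j : nat) :
  ~~ odd d -> i = j %[mod d] -> odd i = odd j.
Proof.
rewrite -dvdn2 => d2 /(eqmodn_dvdr _ _ _ _ d2).
by rewrite !modn2; case: (odd i) (odd j) => [] [].
Qed.

Lemma dvdn_even_odd (d n : nat) : ~~ odd d -> d %| n.+1 -> odd n.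
Proof.
rewrite -dvdn2 => d2 /(dvdn_trans d2).
by rewrite dvdn2 /= negbK.
Qed.

Lemma dvdn_doubleW (d n : nat) : d.*2 %| n -> d %| n.
Proof. by apply: dvdn_trans; rewrite -muln2 dvdn_mulr. Qed.

(** * Equal windows force congruent positions *)

Lemma parity_window (H : nat) (y : nat -> bool) (i j : nat) :
  halving_rule H y -> 0 < H -> ~~ odd H -> 0 < j -> odd i -> ~~ odd j ->
  ~ (forall t, t < 4 * H -> y (i + t) = y (j + t)).
Proof.
move=> [y_even y_odd] H_gt0 H_even j_gt0 i_odd j_even y_eq.
have nH n : H %| n.+1 -> ~~ (H %| n).
  move=> Hn1; apply/negP => Hn; move: Hn1.
  rewrite -addn1 dvdn_addr // dvdn1 => /eqP H1; by rewrite H1 in H_even.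
(* At the even offset 2t the term of i has an odd index, so it is explicit. The term of j halves to
   [j./2 + t], which is odd because H is even, and not divisible by H. *)
have key t : t < H.*2 -> H %| (j./2 + t).+1 ->
  (H %| i.+1./2 + t) = (H.*2 %| (j./2 + t).+1).
  move=> t_lt Ht; have := y_eq t.*2; rewrite -!mul2n in t_lt *.
  move=> /(_ ltac:(lia)).
  rewrite y_odd; last by rewrite oddD i_odd mul2n odd_double.
  have -> : (i + 2 * t).+1 = (i.+1./2 + t).*2 by lia.
  have -> : j + 2 * t = (j./2 + t).*2 by lia.
  rewrite mul2n dvdn_double => ->; rewrite y_even; last by lia.
  by rewrite (negPf (nH _ Ht)) addbF y_odd // (dvdn_even_odd H).
have H2_gt0 : 0 < H.*2 by lia.
have [t t_lt] := ex_dvdn_addr H.*2 (j./2).+1 H2_gt0; rewrite addSn => t_dvd.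
have Ht : H %| (j./2 + t).+1 by apply: dvdn_doubleW.
have Hi : H %| i.+1./2 + t by rewrite key.
(* Moving t by H, in the direction that stays below 2H, preserves both divisibilities by H but
   destroys the one by 2H. *)
have [t' t'_lt tt'] : exists2 t', t' < H.*2 & (t' = t + H \/ t = t' + H).
  by case: (ltnP t H) => tH; [exists (t + H)|exists (t - H)]; lia.
have HD n : (H %| n + H) = (H %| n) by rewrite dvdn_addl.
have Ht' : H %| (j./2 + t').+1.
  by case: tt' Ht => ->; rewrite -!addSn addnA HD.
have Hi' : H %| i.+1./2 + t'.
  by case: tt' Hi => ->; rewrite addnA HD.
have : H.*2 %| H.
  move: (key t' t'_lt Ht') t_dvd; rewrite Hi' => /esym.
  case: tt' => -> A B.
    by move: A; rewrite addnA -addSn dvdn_addr.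
  by move: B; rewrite addnA -addSn dvdn_addr.
move/(dvdn_leq H_gt0); lia.
Qed.

Lemma parity_window_eq (H : nat) (y : nat -> bool) (i j : nat) :
  halving_rule H y -> 0 < H -> ~~ odd H -> 0 < i -> 0 < j ->
  (forall t, t < 4 * H -> y (i + t) = y (j + t)) -> odd i = odd j.
Proof.
move=> yP H_gt0 H_even i_gt0 j_gt0 y_eq.
case i_odd: (odd i); case j_odd: (odd j) => //.
- by case: (@parity_window H y i j); rewrite ?j_odd.
- by case: (@parity_window H y j i); rewrite ?i_odd // => t /y_eq.
Qed.

Lemma double_window (H : nat) (y : nat -> bool) (i j : nat) :
  halving_rule H y -> 0 < H -> odd i = odd j ->
  (forall t, t < H.*2 -> y (i + t) = y (j + t)) -> i = j %[mod H.*2].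
Proof.
move=> [_ y_odd] H_gt0 ij_odd y_eq.
(* Here i + t is odd and y is 1 there. Since j + t is odd as well, the same value makes j + t + 1 a
   multiple of 2H. *)
have [|t t_lt] := ex_dvdn_addr H.*2 i.+1; first by lia.
rewrite addSn => it.
have it_odd : odd (i + t) by apply: dvdn_even_odd it; rewrite odd_double.
apply: (@eqmodn_dvd_addr _ _ _ t.+1); rewrite addnS // -y_odd.
  by rewrite -y_eq // y_odd.
by move: it_odd; rewrite !oddD ij_odd.
Qed.

(** Some offset t < H makes both i + t + 1 and j + t + 1 multiples of H, and y tells there whether
    each multiple is even or odd. Knowing i modulo H thus halves the window needed in
    [double_window]. *)
Lemma half_window (H : nat) (y : nat -> bool) (i j : nat) :
  halving_rule H y -> 0 < H -> ~~ odd H -> i = j %[mod H] ->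
  (forall t, t < H -> y (i + t) = y (j + t)) -> i = j %[mod H.*2].
Proof.
move=> [_ y_odd] H_gt0 H_even ij y_eq.
have [t t_lt] := ex_dvdn_addr H i.+1 H_gt0; rewrite addSn => it.
have := it; rewrite -addnS (eqmodn_dvd _ _ _ _ ij) addnS => jt.
have /y_eq := t_lt.
rewrite !y_odd; [|exact: dvdn_even_odd jt|exact: dvdn_even_odd it].
case it2: (H.*2 %| (i + t).+1) => /esym jt2.
  by apply: (@eqmodn_dvd_addr _ _ _ t.+1); rewrite addnS.
have lift n : H %| n -> (H.*2 %| n) = false -> H.*2 %| n + H.
  move=> /dvdnP[q ->]; rewrite addnC -mulSn -muln2 ![_ * H]mulnC.
  by rewrite !dvdn_pmul2l // !dvdn2 /= => /negbT.
by apply: (@eqmodn_dvd_addr _ _ _ (t.+1 + H)); rewrite addnA addnS lift.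
Qed.

Lemma addn_odd (n : nat) : n + odd n = (uphalf n).*2.
Proof. lia. Qed.

(** Induction on c through the even indices: as i = j modulo H, the summands [H | n] in the halving
    rule agree and cancel, which leaves equal windows of half the length. *)
Lemma dyadic_window (H : nat) (y : nat -> bool) (c i j : nat) :
  halving_rule H y -> 0 < H -> ~~ odd H -> 0 < i -> 0 < j ->
  i = j %[mod H] ->
  (forall t, t < 2 ^ c * H -> y (i + t) = y (j + t)) ->
  i = j %[mod 2 ^ c.+1 * H].
Proof.
move=> yP H_gt0 H_even; elim: c i j => [|c IHc] i j i_gt0 j_gt0 ij y_eq.
  rewrite expn1 mul2n; apply: (half_window H y) => // t t_lt.
  by apply: y_eq; rewrite mul1n.
have c_gt0 : 0 < 2 ^ c by rewrite expn_gt0.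
have ij2 : i = j %[mod H.*2].
  apply: (half_window H y) => // t t_lt; apply: y_eq.
  by rewrite (leq_trans t_lt) // leq_pmull // expn_gt0.
have ij_odd := eqmodn_odd _ _ _ H_even ij.
(* [(uphalf i).*2] is the first even index of the window at i; the window at j needs the same shift
   [odd i]. *)
have iE := addn_odd i.
have jE : j + odd i = (uphalf j).*2 by rewrite ij_odd addn_odd.
have ij' : uphalf i = uphalf j %[mod H].
  by apply/eqmodn_double; rewrite -iE -jE; apply/eqP; rewrite eqn_modDr ij2.
suff /eqmodn_double : uphalf i = uphalf j %[mod 2 ^ c.+1 * H].
  rewrite -iE -jE => /eqP; rewrite eqn_modDr => /eqP.
  by rewrite -mul2n mulnA -expnS.
apply: (IHc _ _ _ _ ij'); rewrite ?uphalf_gt0 // => t t_lt.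
have := y_eq (odd i + t.*2).
have -> : i + (odd i + t.*2) = (uphalf i + t).*2 by rewrite addnA iE doubleD.
have -> : j + (odd i + t.*2) = (uphalf j + t).*2 by rewrite addnA jE doubleD.
rewrite !yP.1 ?addn_gt0 ?uphalf_gt0 ?i_gt0 ?j_gt0 //.
rewrite (eqmodn_dvd _ _ _ t ij') => H0; apply: (addIb (H0 _)).
by clear -t_lt; rewrite expnS -mulnA; lia.
Qed.

(** * Continuing equal windows by one term *)

Lemma halving_rule_eqmod (H : nat) (y : nat -> bool) (l n n' : nat) :
  halving_rule H y -> 0 < n -> 0 < n' -> ~~ (2 ^ l %| n) ->
  n = n' %[mod 2 ^ l * H] -> y n = y n'.
Proof.
move=> [y_even y_odd]; elim: l n n' => [|l IHl] n n'; first by rewrite dvd1n.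
move=> n_gt0 n'_gt0; rewrite expnS -mulnA => ndvd nn'.
have nn'_odd : odd n = odd n' by apply: eqmodn_odd nn'; rewrite oddM.
(* An odd index is reached after fewer than l halvings, when the modulus is still a multiple of
   2H. *)
case n_odd: (odd n).
  rewrite !y_odd -?nn'_odd // -addn1 -[n'.+1]addn1; apply: eqmodn_dvd.
  by apply: eqmodn_dvdr nn'; rewrite -mul2n dvdn_pmul2l // dvdn_mull.
have nE : n = n./2.*2 by rewrite even_halfK // n_odd.
have n'E : n' = n'./2.*2 by rewrite even_halfK // -nn'_odd n_odd.
have h_gt0 : 0 < n./2 by rewrite -double_gt0 -nE.
have h'_gt0 : 0 < n'./2 by rewrite -double_gt0 -n'E.
move: nn'; rewrite nE n'E mul2n => /eqmodn_double nn'.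
rewrite !y_even // (IHl n./2 n'./2) //.
  congr (_ (+) _); rewrite -[n./2]addn0 -[n'./2]addn0; apply: eqmodn_dvd.
  by apply: eqmodn_dvdr nn'; rewrite dvdn_mull.
by move: ndvd; rewrite {1}nE mul2n dvdn_double.
Qed.

(** Each doubling adds the same bit on both sides, because congruent a and b give multiples of H
    simultaneously. *)
Lemma halving_rule_expn (H : nat) (y : nat -> bool) (l a b : nat) :
  halving_rule H y -> 0 < a -> 0 < b -> a = b %[mod H] ->
  (y (2 ^ l * a) == y (2 ^ l * b)) = (y a == y b).
Proof.
move=> [y_even y_odd] a_gt0 b_gt0 ab; elim: l => [|l IHl].
  by rewrite !mul1n.
rewrite expnS -!mulnA ![2 * (_ * _)]mul2n.
have l_gt0 : 0 < 2 ^ l by rewrite expn_gt0.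
rewrite !y_even ?muln_gt0 ?l_gt0 //.
have -> : (H %| 2 ^ l * a) = (H %| 2 ^ l * b).
  by rewrite /dvdn -modnMmr ab modnMmr.
by rewrite -IHl (inj_eq (@addIb _)).
Qed.

(** The range ends just before 4H - 2, the double of 2H - 1, where y is 1 again. Within it an even n
    has n/2 below 2H - 1, so that only n/2 = H can contribute. *)
Lemma halving_rule_small (H : nat) (y : nat -> bool) (n : nat) :
  halving_rule H y -> 1 < H -> 0 < n -> n + 3 <= 4 * H ->
  y n = (n == (2 * H).-1) || (n == 2 * H).
Proof.
move=> [y_even y_odd] H_gt1; elim/ltn_ind: n => n IHn n_gt0 n_le.
case n_odd: (odd n).
  rewrite y_odd // -mul2n.
  have -> : (n == 2 * H) = false by lia.
  rewrite orbF; apply/idP/idP => [/dvdnP[q qE]|/eqP->].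
    have : q < 2 by rewrite -(@ltn_pmul2r (2 * H)) -?qE; lia.
    by case: q qE => [|[|//]] qE _; apply/eqP; lia.
  by rewrite prednK //; lia.
have nE : n = n./2.*2 by lia.
rewrite [in LHS]nE y_even; last by lia.
have h_lt : n./2 < 2 * H by lia.
rewrite IHn; [|by lia|by lia|by lia].
have -> : (n./2 == 2 * H) = false by lia.
have -> : (n./2 == (2 * H).-1) = false by lia.
have -> /= : (n == (2 * H).-1) = false by lia.
apply/idP/idP => [/dvdnP[q qE]|/eqP nH]; last first.
  by have -> : n./2 = H by lia.
have : q < 2 by rewrite -(@ltn_pmul2r H) -?qE; lia.
by case: q qE => [|[|//]] qE _; apply/eqP; lia.
Qed.

(** Neither window can continue with 1. That 1 would stand at 2H - 1 or 2H; unless this already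
    violates the range, one of these two indices lies inside a window, at an offset where the other
    window has 0. *)
Lemma small_window_extend (H : nat) (y : nat -> bool) (a q : nat) :
  halving_rule H y -> 1 < H -> 0 < a -> 0 < q ->
  a + q * H + H.-1 < 2 * (2 * H).-1 ->
  (forall t, t < H.-1 -> y (a + t) = y (a + q * H + t)) ->
  y (a + H.-1) = y (a + q * H + H.-1).
Proof.
move=> yP H_gt1 a_gt0 q_gt0 b_le y_eq.
have ys n : 0 < n -> n + 3 <= 4 * H ->
    y n <-> (n = (2 * H).-1 \/ n = 2 * H).
  move=> n_gt0 n_le; rewrite (@halving_rule_small H) //.
  by split=> [/orP[]/eqP|[]/eqP nE]; [left|right|rewrite nE|rewrite nE orbT].
have : q = 1 \/ q = 2.
  have : q < 3 by rewrite -(@ltn_pmul2r H); lia.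
  by lia.
case=> qE; subst q; apply/idP/idP => /ys E; have {}E := E ltac:(lia) ltac:(lia);
  try by exfalso; lia.
- have [aE|aE] : a = H \/ a = H.+1 by lia.
    have : y (a + 0) by rewrite y_eq; [apply/ys; lia|lia].
    by case/ys; lia.
  have : y (a + 1 * H + (H - 2)) by rewrite -y_eq; [apply/ys; lia|lia].
  by case/ys; lia.
have aE : a = 1 by lia.
have : y (a + (H - 2)) by rewrite y_eq; [apply/ys; lia|lia].
by case/ys; lia.
Qed.

Lemma window_extend (H : nat) (y : nat -> bool) (l i j : nat) :
  halving_rule H y -> 1 < H -> 0 < i -> i < j ->
  i = j %[mod 2 ^ l * H] ->
  (forall t, t < 2 ^ l * H.-1 -> y (i + t) = y (j + t)) ->
  j + 2 ^ l * H.-1 < 2 ^ l.+1 * (2 * H).-1 ->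
  y (i + 2 ^ l * H.-1) = y (j + 2 ^ l * H.-1).
Proof.
move=> yP H_gt1 i_gt0 ij ijE y_eq j_lt.
have l_gt0 : 0 < 2 ^ l by rewrite expn_gt0.
have j_gt0 : 0 < j by apply: leq_trans ij.
have [/dvdnP[a ia]|ndvd] := boolP (2 ^ l %| i); last first.
  apply: (@halving_rule_eqmod H y l) => //; rewrite ?addn_gt0 ?i_gt0 ?j_gt0 //.
    by rewrite dvdn_addl // dvdn_mulr.
  by apply/eqP; rewrite eqn_modDr ijE.
have /dvdnP[b jb] : 2 ^ l %| j.
  have := @eqmodn_dvd (2 ^ l) i j 0; rewrite !addn0 => <-.
    by rewrite ia dvdn_mull.
  by apply: eqmodn_dvdr ijE; rewrite dvdn_mulr.
(* On the multiples of 2^l, division by 2^l leaves windows of length H - 1 at a and b, with b + H -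
   1 < 2 (2H - 1). *)
rewrite {i}ia {j}jb in i_gt0 j_gt0 ij ijE y_eq j_lt *.
rewrite !(mulnC _ (2 ^ l)) in i_gt0 j_gt0 ij ijE y_eq j_lt *.
move: i_gt0 j_gt0 ij j_lt; rewrite !muln_gt0 l_gt0 ltn_pmul2l //= -mulnDr.
rewrite expnSr -mulnA ltn_pmul2l // => a_gt0 b_gt0 ab b_le.
move/eqP: ijE; rewrite -!muln_modr eqn_pmul2l // => /eqP abE.
have /dvdnP[q qE] : H %| b - a by rewrite -eqn_mod_dvd ?abE // ltnW.
have bE : b = a + q * H by rewrite -qE subnKC // ltnW.
have ab_t t : a + t = b + t %[mod H] by apply/eqP; rewrite eqn_modDr abE.
apply/eqP; rewrite -!mulnDr (@halving_rule_expn H y l) //;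
  rewrite ?addn_gt0 ?a_gt0 ?b_gt0 //.
apply/eqP; rewrite bE; apply: small_window_extend => //.
- by case: (posnP q) bE => // ->; rewrite mul0n addn0 => bE;
    rewrite bE ltnn in ab.
- by rewrite -bE.
move=> t t_lt; rewrite -bE.
apply/eqP; rewrite -(@halving_rule_expn H y l) ?addn_gt0 ?a_gt0 ?b_gt0 //.
by rewrite !mulnDr y_eq // ltn_pmul2l.
Qed.

(** * Recurrences as a condition on windows *)

Lemma F2_eq01 (a : 'F_2) : a = 0%R \/ a = 1%R.
Proof. by case: a => -[|[|//]] a_lt; [left|right]; apply: val_inj. Qed.

Section Interpolation.
Import mpoly.

Lemma has_recurrenceP (s : nat -> 'F_2) (N M : nat) :
  has_recurrence s N M <->
  forall i j, i + M < N -> j + M < N ->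
    (forall t, t < M -> s (i + t) = s (j + t)) -> s (i + M) = s (j + M).
Proof.
split=> [[f fP] i j iN jN sij|sP].
  by rewrite !fP //; apply: meval_eq => t; apply: sij.
(* The successor of the word w; the value 0 for words that have no successor in the sequence is
   arbitrary. *)
pose g (w : {ffun 'I_M -> 'F_2}) : 'F_2 :=
  if [pick i : 'I_N | (i + M < N) && [forall t : 'I_M, s (i + t) == w t]]
  is Some i then s (i + M) else 0%R.
(* Interpolation over F_2: the product of the factors X_t + w_t + 1 is the indicator of the point
   w. *)
exists (\sum_(w : {ffun 'I_M -> 'F_2})
  (g w)%:MP * \prod_(t < M) ('X_t + (w t + 1)%:MP))%R.
move=> i iN; rewrite raddf_sum /=.
pose w0 : {ffun 'I_M -> 'F_2} := [ffun t : 'I_M => s (i + t)].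
have F2_1 (a : 'F_2) : (a + (a + 1) = 1)%R.
  by case: (F2_eq01 a) => ->; apply: val_inj.
rewrite (bigD1 w0) //= [X in (_ + X)%R]big1 => [|w w_neq]; last first.
  rewrite rmorphM rmorph_prod /=.
  have [t wt] : exists t, w t != w0 t.
    apply/existsP; apply: contraNT w_neq; rewrite negb_exists => /forallP w_eq.
    by apply/eqP/ffunP => t; apply/eqP; rewrite -[_ == _]negbK w_eq.
  rewrite (bigD1 t) //= rmorphD /= mevalXU !mevalC.
  suff -> : (s (i + t)%N + (w t + 1) = 0)%R by rewrite mul0r mulr0.
  move: wt; rewrite ffunE.
  by case: (F2_eq01 (w t)) (F2_eq01 (s (i + t))) => -> [] -> // _;
    apply/val_inj.
rewrite addr0 rmorphM rmorph_prod /= mevalC big1 ?mulr1 => [|t _]; last first.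
  by rewrite rmorphD /= mevalXU mevalC ffunE.
have i_lt : i < N by apply: leq_ltn_trans (leq_addr M i) iN.
rewrite /g; case: pickP => [j /andP[jN /forallP j_eq]|/(_ (Ordinal i_lt))] /=.
  apply: sP => // t tM; have /eqP := j_eq (Ordinal tM).
  by rewrite ffunE /= => ->.
by rewrite iN /= => /negP[]; apply/forallP => t; rewrite ffunE.
Qed.

End Interpolation.

(** * Differences of the pattern sequence *)

Definition flip (k n : nat) : bool := pattern_seq k n.-1 != pattern_seq k n.

Lemma pattern_seq_double (k n : nat) : 0 < k ->
  pattern_seq k n.*2 = pattern_seq k n.
Proof.
move=> k_gt0; case: n => // n; rewrite pattern_seqE // doubleK.
have k2 : 2 %| 2 ^ k by rewrite dvdn_exp.
case: eqP => // /(eqmodn_dvdr _ _ _ _ k2); rewrite !modn2 odd_double.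
have : odd (2 ^ k).-1.+1 = false.
  by rewrite prednK ?expn_gt0 // oddX; case: k k_gt0 k2.
by rewrite /= => /negbFE ->.
Qed.

Lemma pattern_seq_double1 (k n : nat) : 0 < k ->
  pattern_seq k n.*2.+1 =
    if 2 ^ k.-1 %| n.+1 then (pattern_seq k n + 1)%R else pattern_seq k n.
Proof.
move=> k_gt0; rewrite pattern_seqE // (half_bit_double n true).
suff -> : (n.*2.+1 == (2 ^ k).-1 %[mod 2 ^ k]) = (2 ^ k.-1 %| n.+1) by [].
rewrite -(eqn_modDr 1) !addn1 prednK ?expn_gt0 // modnn -/(dvdn _ _).
by rewrite -doubleS -[k in LHS]prednK // expnS mul2n dvdn_double.
Qed.

Lemma pattern_seqS (k n : nat) :
  (pattern_seq k n.+1 = pattern_seq k n + (flip k n.+1)%:R)%R.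
Proof.
rewrite /flip /=.
by case: (F2_eq01 (pattern_seq k n)) (F2_eq01 (pattern_seq k n.+1)) => -> [] ->;
  apply: val_inj.
Qed.

(** With H = 2^(k-1), p_(2n) = p_n and p_(2n-1) = p_(n-1) + [H | n] give the even case; p_(2n) and
    p_(2n+1) differ exactly when H | n + 1, which gives the odd case. *)
Lemma flip_halving_rule (k : nat) : 0 < k -> halving_rule (2 ^ k.-1) (flip k).
Proof.
move=> k_gt0; split=> [[//|n] _|n n_odd]; rewrite /flip.
  rewrite pattern_seq_double // doubleS /= pattern_seq_double1 //.
  case: ifP => _; last by rewrite addbF.
  by case: (F2_eq01 (pattern_seq k n)) (F2_eq01 (pattern_seq k n.+1));
    move=> -> [] ->.
have -> : n = n./2.*2.+1 by rewrite -[LHS]odd_double_half n_odd.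
rewrite /= pattern_seq_double // pattern_seq_double1 //.
rewrite -doubleS dvdn_double.
case: ifP => _; last by rewrite eqxx.
by case: (F2_eq01 (pattern_seq k n./2)) => ->.
Qed.

Lemma expn_pred_gt1 (k : nat) : 1 < k -> 1 < 2 ^ k.-1.
Proof. by case: k => [|[|k]] // _; rewrite -{1}(expn0 2) ltn_exp2l. Qed.

Lemma pattern_seq_exp2 (k n : nat) : 1 < k -> pattern_seq k (2 ^ n) = 0%R.
Proof.
move=> k_gt1; have k_gt0 := ltnW k_gt1; elim: n => [|n IHn]; last first.
  by rewrite expnS mul2n pattern_seq_double.
rewrite -[2 ^ 0]/(0.*2.+1) pattern_seq_double1 // dvdn1.
by rewrite gtn_eqF ?expn_pred_gt1.
Qed.

Lemma pattern_seq_eq_window (k i j T : nat) :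
  pattern_seq k i = pattern_seq k j ->
  (forall t, t < T -> flip k (i.+1 + t) = flip k (j.+1 + t)) ->
  forall t, t <= T -> pattern_seq k (i + t) = pattern_seq k (j + t).
Proof.
move=> ij y_eq; elim=> [|t IHt] tT; first by rewrite !addn0.
by rewrite !addnS !pattern_seqS IHt ?(ltnW tT) // -!addSn y_eq.
Qed.

(** * Upper and lower bounds *)

Lemma pattern_seq_recurrence (k l N : nat) : 1 < k -> 2 < l ->
  N <= 2 ^ l.+1 * (2 * 2 ^ k.-1).-1 ->
  has_recurrence (pattern_seq k) N (2 ^ l * (2 ^ k.-1).-1).+1.
Proof.
move=> k_gt1 l_gt2 N_le; apply/has_recurrenceP.
have yP := flip_halving_rule k (ltnW k_gt1).
have H_gt1 := expn_pred_gt1 k k_gt1.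
have H_even : ~~ odd (2 ^ k.-1).
  by rewrite oddX orbF; case: k k_gt1 {N_le yP H_gt1} => [|[]].
move: (2 ^ k.-1) yP H_gt1 H_even N_le => H yP H_gt1 H_even N_le.
have H_gt0 := ltnW H_gt1.
set m := 2 ^ l * H.-1.
(* This is where l >= 3 enters: 8 (H - 1) >= 4H for H >= 2, as the parity argument requires. *)
have l8 : 8 <= 2 ^ l by rewrite -[8]/(2 ^ 3) leq_exp2l.
have m_ge4H : 4 * H <= m.
  apply: (@leq_trans (8 * H.-1)); first by clear -H_gt1; lia.
  by rewrite leq_mul2r l8 orbT.
have m_ge2H : H.*2 <= m by apply: leq_trans m_ge4H; clear; lia.
have m_ge : 2 ^ l.-1 * H <= m.
  have -> : m = 2 ^ l.-1 * (2 * H.-1).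
    by rewrite mulnA -expnSr prednK // (leq_trans _ l_gt2).
  by rewrite leq_mul2l; apply/orP; right; clear -H_gt1; lia.
move=> i j; wlog ij : i j / i < j => [wlog_ij iN jN p_eq|iN jN p_eq].
  have [ij|ji|->//] := ltngtP i j; first exact: wlog_ij.
  by apply/esym/wlog_ij => // t /p_eq.
(* The m + 1 terms of a window of p determine m differences, the first of them at index i + 1. *)
have y_eq t : t < m -> flip k (i.+1 + t) = flip k (j.+1 + t).
  move=> tm; rewrite /flip !addSn /= -!addnS !p_eq //.
  by rewrite ltnS ltnW.
have ij_odd : odd i.+1 = odd j.+1.
  apply: (parity_window_eq H (flip k)) => // t t_lt.
  by apply: y_eq; apply: leq_trans m_ge4H.
have ij_2H : i.+1 = j.+1 %[mod H.*2].
  apply: (double_window H (flip k)) => // t t_lt.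
  by apply: y_eq; apply: leq_trans m_ge2H.
have ij_mod : i.+1 = j.+1 %[mod 2 ^ l * H].
  rewrite -[l]prednK ?(leq_trans _ l_gt2) //.
  apply: (dyadic_window H (flip k)) => // [|t t_lt]; last first.
    by apply: y_eq; apply: leq_trans m_ge.
  by apply: eqmodn_dvdr ij_2H; rewrite -mul2n dvdn_mull.
rewrite !addnS !pattern_seqS p_eq // -!addSn; congr (_ + _%:R)%R.
congr nat_of_bool; apply: (window_extend H) => //.
by rewrite addSn -addnS; apply: leq_trans N_le.
Qed.

Lemma pattern_seq_no_recurrence (k l N m : nat) : 1 < k ->
  2 ^ l * (2 * 2 ^ k.-1).-1 < N -> 0 < m <= 2 ^ l * (2 ^ k.-1).-1 ->
  ~ has_recurrence (pattern_seq k) N m.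
Proof.
move=> k_gt1 N_gt /andP[m_gt0 m_le] /has_recurrenceP rec.
have yP := flip_halving_rule k (ltnW k_gt1).
have H_gt1 := expn_pred_gt1 k k_gt1.
have p0 : pattern_seq k (2 ^ l * 2 ^ k.-1) = 0%R.
  by rewrite -expnD pattern_seq_exp2.
move: (2 ^ k.-1) yP H_gt1 N_gt m_le p0 => H yP H_gt1 N_gt m_le p0.
have l_gt0 : 0 < 2 ^ l by rewrite expn_gt0.
set T := 2 ^ l * H.-1 in m_le.
have T_gt0 : 0 < T := leq_trans m_gt0 m_le.
have TE : 2 ^ l * H + T = 2 ^ l * (2 * H).-1.
  by rewrite /T -mulnDr; congr (_ * _); clear -H_gt1; lia.
have y_mul s : 0 < s -> (flip k (2 ^ l * s) == flip k (2 ^ l * H + 2 ^ l * s))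
    = (flip k s == flip k (H + s)).
  move=> s_gt0; rewrite -mulnDr (halving_rule_expn H (flip k)) //.
    by rewrite addn_gt0 s_gt0 orbT.
  by rewrite modnDl.
(* For 0 < s < H the value at s is 0, and H + s meets an index with value 1 only at 2H - 1. *)
have y_small s : 0 < s -> s < H -> (flip k s == flip k (H + s)) = (s != H.-1).
  move=> s_gt0 sH; rewrite !(halving_rule_small H (flip k)) //;
    clear -s_gt0 sH H_gt1; [|lia..].
  have -> : (s == (2 * H).-1) || (s == 2 * H) = false by lia.
  by have -> : (H + s == (2 * H).-1) || (H + s == 2 * H) = (s == H.-1) by lia.
have y_eq t : t < T.-1 -> flip k (1 + t) = flip k ((2 ^ l * H).+1 + t).
  rewrite add1n addSnnS -ltnS prednK // => tT.
  have [/dvdnP[s sE]|ndvd] := boolP (2 ^ l %| t.+1); last first.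
    apply: (halving_rule_eqmod H _ l) => //; first by rewrite addn_gt0 orbT.
    by rewrite modnDl.
  move: tT; rewrite sE mulnC /T ltn_pmul2l // => sH.
  have s_gt0 : 0 < s by case: s sE {sH}.
  have sH' : s < H by clear -sH; lia.
  by have := y_small s s_gt0 sH'; rewrite -y_mul // ltn_eqF // => /eqP.
have y_neq : flip k T != flip k (2 ^ l * H + T).
  rewrite y_mul ?y_small ?eqxx //; clear -H_gt1; lia.
have p_eq := pattern_seq_eq_window k 0 _ T.-1 (esym p0) y_eq.
(* The sequence and its shift by 2^l H agree on 0, .., T - 1 and differ at T; the last m of these T
   terms form equal windows with distinct successors. *)
have p_eqm :
    pattern_seq k (T - m + m) = pattern_seq k (2 ^ l * H + (T - m) + m).
  apply: rec.
  - by rewrite subnK //; apply: leq_ltn_trans N_gt; rewrite -TE leq_addl.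
  - by rewrite -addnA subnK // TE.
  by move=> t tm; rewrite -addnA -p_eq //; clear -tm m_le T_gt0; lia.
move: p_eqm; rewrite -addnA subnK // -[T]prednK // addnS !pattern_seqS.
rewrite -p_eq // add0n => /addrI /eqP.
rewrite -!addnS prednK //; move: y_neq.
by case: (flip k T) (flip k (2 ^ l * H + T)) => [] [].
Qed.

(* The complexity and its logarithmic form *)
From mathcomp Require Import all_classical all_reals all_analysis.

Lemma max_order_complexityE (s : nat -> 'F_2) (N M : nat) :
  (exists2 i, i < N.-1 & s i != s 0) -> has_recurrence s N M.+1 ->
  (forall m, 0 < m <= M -> ~ has_recurrence s N m) ->
  max_order_complexity s N = M.+1.
Proof.
move=> [i iN si] sM sm; rewrite /max_order_complexity.
case: ifPn => [/forallP/(_ (Ordinal iN))/=|_]; first by rewrite (negPf si).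
case: ex_minnP => m /andP[m_gt0 /asboolP m_rec] m_min.
apply/eqP; rewrite eqn_leq m_min /=; last exact/asboolP.
rewrite ltnNge; apply/negP => mM; apply: sm m_rec.
by rewrite m_gt0.
Qed.

Lemma pattern_seq_complexity (k l N : nat) : 1 < k -> 2 < l ->
  2 ^ l * (2 ^ k).-1 < N <= 2 ^ l.+1 * (2 ^ k).-1 ->
  max_order_complexity (pattern_seq k) N = (2 ^ l * (2 ^ k.-1).-1).+1.
Proof.
move=> k_gt1 l_gt2; have kE : 2 ^ k = 2 * 2 ^ k.-1.
  by rewrite -expnS prednK // ltnW.
rewrite {}kE => /andP[N_gt N_le]; apply: max_order_complexityE.
- have yP := flip_halving_rule k (ltnW k_gt1).
  have H_gt1 := expn_pred_gt1 k k_gt1.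
  move: (2 ^ k.-1) yP H_gt1 N_gt => H yP H_gt1 N_gt {N_le}.
  (* The difference at 2H - 1 is 1, so p at 2H - 2 or at 2H - 1 differs from p_0; both indices must
     be below N - 1. *)
  have N_gt' : (2 * H).-1 < N.-1.
    have l4 : 4 <= 2 ^ l by rewrite -[4]/(2 ^ 2) leq_exp2l // ltnW.
    have := leq_mul l4 (leqnn (2 * H).-1); clear -N_gt H_gt1; lia.
  have : flip k (2 * H).-1.
    by rewrite (halving_rule_small H (flip k)) ?eqxx //; clear -H_gt1; lia.
  have [p_eq|p_neq] := eqVneq (pattern_seq k (2 * H).-1) (pattern_seq k 0).
    rewrite /flip p_eq; exists (2 * H).-2 => //.
    by apply: leq_ltn_trans N_gt'; apply: leq_pred.
  by exists (2 * H).-1.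
- exact: pattern_seq_recurrence.
- by move=> m; apply: pattern_seq_no_recurrence.
Qed.

Lemma ceil_log2_eq (R : realType) (x : R) (l : nat) :
  (2 ^+ l < x -> x <= 2 ^+ l.+1 -> Num.ceil (ln x / ln 2) = l.+1%:Z :> int)%R.
Proof.
move=> lx xl; have ln2_gt0 : (0 < ln (2 : R))%R by rewrite ln_gt0 // ltr1n.
have x_gt0 : (0 < x)%R by apply: lt_trans lx; rewrite exprn_gt0.
apply: ceil_def; rewrite -addn1 PoszD addrK -PoszD addn1.
rewrite ltr_pdivlMr // ler_pdivrMr // -!pmulrn !mulr_natl -!lnXn //.
by rewrite ltr_ln ?ler_ln ?posrE ?exprn_gt0 // lx.
Qed.

Local Open Scope ring_scope.

Theorem theorem2 (R : realType) (k N : nat)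
    (k_ge2 : (2 <= k)%N) (N_ge : (2 ^ (k + 3) - 7 <= N)%N) :
  let l : int := Num.ceil (ln (N%:R / (2 ^+ k - 1) : R) / ln 2) - 1 in
  (max_order_complexity (pattern_seq k) N)%:R
    = (2 ^+ (k - 1) - 1) * 2 ^ l + 1 :> R.
Proof.
have k_gt1 : (1 < 2 ^ k)%N by rewrite -{1}(expn0 2) ltn_exp2l // ltnW.
(* The least such L is the ceiling of the binary logarithm of N / (2^k - 1). *)
have [L N_le L_min] : exists2 L, (N <= 2 ^ L * (2 ^ k).-1)%N
    & forall L', (N <= 2 ^ L' * (2 ^ k).-1)%N -> (L <= L')%N.
  have ex_L : exists L, (N <= 2 ^ L * (2 ^ k).-1)%N.
    exists N; apply: (leq_trans (ltnW (ltn_expl N (ltnSn 1)))).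
    by rewrite leq_pmulr // -subn1 subn_gt0.
  by case: (ex_minnP ex_L) => L; exists L.
(* The bound on N equals 8 (2^k - 1) + 1, just too large for L = 3. *)
have L_gt3 : (3 < L)%N.
  rewrite ltnNge; apply/negP => L_le; move: N_le; rewrite leqNgt => /negP[].
  apply: leq_trans N_ge; rewrite addnC expnD.
  apply: (@leq_ltn_trans (8 * (2 ^ k).-1)%N).
    by rewrite leq_mul2r -[8%N]/(2 ^ 3)%N leq_exp2l // L_le orbT.
  by clear -k_gt1; lia.
case: L L_gt3 N_le L_min => // l l_gt2 N_le L_min.
have N_gt : (2 ^ l * (2 ^ k).-1 < N)%N.
  by rewrite ltnNge; apply/negP => /L_min; rewrite ltnn.
rewrite (pattern_seq_complexity k l) ?N_gt //=.
have predE n : ((2 ^ n).-1%:R = 2 ^+ n - 1 :> R)%R.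
  by rewrite -subn1 natrB ?expn_gt0 // natrX.
have d_gt0 : 0 < 2 ^+ k - 1 :> R by rewrite -predE ltr0n -subn1 subn_gt0.
rewrite (ceil_log2_eq _ _ l).
- have -> : (l.+1%:Z - 1 = l)%R by rewrite -addn1 PoszD addrK.
  by rewrite -addn1 natrD natrM natrX predE mulrC subn1.
- by rewrite ltr_pdivlMr // -predE -natrX -natrM ltr_nat.
- by rewrite ler_pdivrMr // -predE -natrX -natrM ler_nat.
Qed.
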